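(* Let $n\ge 3$ be a prime number. Then every AG-groupoid in $Z_{AG}^{*}(n)$ is a cancellative AG-groupoid.
   Context: A groupoid is a set with a binary operation. For $t,u\in Z_n=\{0,1,\dots,n-1\}$, $Z_n(t,u)$ denotes the groupoid on $Z_n$ with operation $a\cdot b = ta+ub \pmod n$. An AG-groupoid is a groupoid $G$ satisfying $(ab)c=(cb)a$ for all $a,b,c\in G$. The class $Z_{AG}^{*}(n)$ consists of the AG-groupoids $Z_n(t,u)$ with $t,u\in Z_n\setminus\{0\}$, $t\ne u$ (not necessarily relatively prime) and $t^2\equiv u\pmod n$. An AG-groupoid $G$ is called cancellative if for all $a,x,y\in G$, $ax=ay$ implies $x=y$. *)

(* Defs.v *)
From HB Require Import structures.
From mathcomp Require Import all_boot.

Set Implicit Arguments.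
Unset Strict Implicit.
Unset Printing Implicit Defensive.

Local Open Scope group_scope.

(* A groupoid (a set with a binary operation) is a [magmaType]. *)

Definition AG_groupoid (G : magmaType) : Prop :=
  forall a b c : G, (a * b) * c = (c * b) * a.

(* Only left cancellation is required. *)
Definition cancellative (G : magmaType) : Prop :=
  forall a x y : G, a * x = a * y -> x = y.

Definition cancellative_AG_groupoid (G : magmaType) : Prop :=
  AG_groupoid G /\ cancellative G.

(* An alias of 'I_n, so that each pair (t, u) carries its own magma structure
   and none is put on 'I_n itself. *)
Definition Zgroupoid (n : nat) (t u : 'I_n) : Type := 'I_n.

Lemma Zgroupoid_mul_subproof (n : nat) (t u a b : 'I_n) :
  ((t * a + u * b) %% n < n)%N.
Proof. by rewrite ltn_pmod // (leq_ltn_trans (leq0n t) (ltn_ord t)). Qed.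

Definition Zgroupoid_mul (n : nat) (t u : 'I_n) (a b : Zgroupoid t u) :
    Zgroupoid t u :=
  Ordinal (Zgroupoid_mul_subproof t u a b).

HB.instance Definition _ (n : nat) (t u : 'I_n) :=
  hasMul.Build (Zgroupoid t u) (@Zgroupoid_mul n t u).

(* The class is a set of groupoids, so membership is equality with some
   Z_n(t,u) as a magma, i.e. same carrier and same operation. *)
Definition ZAG_star (n : nat) (G : magmaType) : Prop :=
  exists t u : 'I_n,
    [/\ (t : nat) <> 0%N, (u : nat) <> 0%N, t <> u,
        t ^ 2 = u %[mod n]
      & AG_groupoid (Zgroupoid t u) /\ G = Zgroupoid t u :> magmaType].

(* Main.v *)
Require Import Defs.
From mathcomp Require Import all_boot.

(** Left multiplication by a in Z_n(t,u) is the affine map x |-> ta + ux on the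
    residues modulo n, so it is injective as soon as u is invertible modulo n.
    When n is prime, every nonzero u in Z_n is invertible, which gives
    cancellation ([Zgroupoid_cancellative]). The AG law is part of the
    membership in the class. *)

Lemma eqn_mod_coprimeMl (d k x y : nat) :
  coprime d k -> (k * x == k * y %[mod d]) = (x == y %[mod d]).
Proof.
move=> co_dk; wlog le_yx : x y / y <= x => [IH|].
  case/orP: (leq_total y x) => [|le_xy]; first exact: IH.
  by rewrite eq_sym IH // eq_sym.
by rewrite !eqn_mod_dvd ?leq_mul2l ?le_yx ?orbT // -mulnBr Gauss_dvdr.
Qed.

Lemma Zgroupoid_cancellative (n : nat) (t u : 'I_n) :
  coprime n u -> cancellative (Zgroupoid t u).
Proof.
move=> co_nu a x y /(congr1 val) /= /eqP.
rewrite eqn_modDl eqn_mod_coprimeMl // !modn_small ?ltn_ord // => /eqP.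
exact: val_inj.
Qed.

Theorem theorem5 (n : nat) (hn : (3 <= n)%N) (hp : prime n) (G : magmaType)
  (hG : ZAG_star n G) : cancellative_AG_groupoid G.
Proof.
case: hG => t [u [_ /eqP u_neq0 _ _ [AG_tu ->]]]; split=> //.
apply: Zgroupoid_cancellative.
by rewrite prime_coprime // gtnNdvd ?ltn_ord // lt0n.
Qed.
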